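(* (Subject reduction.) Let $\Gamma \vdash M: C$ be a type assignment derivable in $\mathsf{ND}_{\mathsf{CK}}$. If $M\rightsquigarrow_{\beta\eta\kappa} N$, then $\Gamma \vdash N: C$ is derivable in $\mathsf{ND}_{\mathsf{CK}}$.
   Context: Types: $A ::= a \mid (A\to A) \mid \Box A$ ($a$ atoms). Modal $\lambda$-terms: $M,N ::= x \mid \lambda x.M \mid MN \mid M[N_1,\ldots,N_n/x_1,\ldots,x_n]$ (explicit substitution; $x_1,\ldots,x_n$ distinct and bound in $M$), modulo $\alpha$-equivalence (Barendregt convention) and simultaneous permutation of the pairs $N_i/x_i$. Vectors $\vec P$ abbreviate lists of terms/variables. $FV(x)=\{x\}$, $FV(\lambda x.N)=FV(N)\setminus\{x\}$, $FV(NP)=FV(N)\cup FV(P)$, $FV(N[\vec P/\vec x])=\bigcup_i FV(P_i)$; $M\{N/x\}$ is capture-avoiding substitution. Contexts are lists of declarations $x:A$ with distinct variables. System $\mathsf{ND}_{\mathsf{CK}}$: (Id) $x_1:A_1,\ldots,x_n:A_n\vdash x_i:A_i$; (Abs) from $\Gamma,x:A\vdash M:C$ infer $\Gamma\vdash\lambda x.M:A\to C$; (App) from $\Gamma\vdash N:A$ and $\Gamma\vdash M:A\to C$ infer $\Gamma\vdash MN:C$; ($\Box$-subst) from $\Gamma\vdash N_i:\Box A_i$ ($i=1..n$) and $x_1:A_1,\ldots,x_n:A_n\vdash M:C$ infer $\Gamma\vdash M[N_1,\ldots,N_n/x_1,\ldots,x_n]:\Box C$, with $x_1,\ldots,x_n$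 not occurring in $\Gamma$. $\Lambda$ is the set of terms having a derivable type assignment; $\Lambda^\lambda$ (resp. $\Lambda^\Box$) the $\lambda$-abstractions (resp. explicit substitutions) in $\Lambda$. Ground steps: ($\beta_1$) $(\lambda x.M)N \to M\{N/x\}$; ($\beta_2$) $M[\vec P, R[\vec N/\vec z], \vec Q/\vec x, y, \vec w] \to (M\{R/y\})[\vec P,\vec N,\vec Q/\vec x,\vec z,\vec w]$; ($\eta_1$) $M\to \lambda x.Mx$ if $\Gamma\vdash M:A\to B$ is derivable, $x\notin FV(M)$ and $M\notin\Lambda^\lambda$; ($\eta_2$) $M\to x[M/x]$ if $\Gamma\vdash M:\Box A$ is derivable, $x\notin FV(M)$ and $M\notin\Lambda^\Box$; ($\kappa_1$) $M[\vec P,N,\vec Q/\vec x,y,\vec z]\to M[\vec P,\vec Q/\vec x,\vec z]$ if $y$ has no free occurrence in $M$; ($\kappa_2$) $M[\vec P,N,N,\vec Q/\vec x,y_1,y_2,\vec z]\to (M\{v,v/y_1,y_2\})[\vec P,N,\vec Q/\vec x,v,\vec z]$ with $v$ fresh. Terms with a hole: $\mathsf C ::= \circ \mid \lambda x.\mathsf C \mid M\mathsf C \mid \mathsf C M \mid \mathsf C[\vec M/\vec x] \mid M[\vec N_1,\mathsf C,\vec N_2/\vec x_1,x,\vec x_2]$; $\mathsf E ::= \circ \mid \lambda x.\mathsf E \mid M\mathsf E \mid \mathsf E' M \mid \mathsf E[\vec M/\vec x] \mid M[\vec N_1,\mathsf E,\vec N_2/\vec x_1,x,\vec x_2]$ where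 $\mathsf E'$ is such a context different from $\circ$; $\mathsf D ::= \circ \mid \lambda x.\mathsf D \mid M\mathsf D \mid \mathsf D M \mid \mathsf D[\vec M/\vec x] \mid M[\vec N_1,\mathsf D',\vec N_2/\vec x_1,x,\vec x_2]$ where $\mathsf D'\neq\circ$. $\mathsf C\langle M\rangle$ is the result of replacing $\circ$ by $M$. Then $\mathsf C\langle M\rangle\rightsquigarrow_\beta\mathsf C\langle N\rangle$ (resp. $\rightsquigarrow_\kappa$) for every $\mathsf C$ if $M\to N$ by $\beta_1$ or $\beta_2$ (resp. $\kappa_1$ or $\kappa_2$); $\mathsf E\langle M\rangle\rightsquigarrow_\eta\mathsf E\langle N\rangle$ if $M\to N$ by $\eta_1$; $\mathsf D\langle M\rangle\rightsquigarrow_\eta\mathsf D\langle N\rangle$ if $M\to N$ by $\eta_2$. Finally $\rightsquigarrow_{\beta\eta\kappa}=\rightsquigarrow_\beta\cup\rightsquigarrow_\eta\cup\rightsquigarrow_\kappa$.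
   Formalization: λ-abstractions carry the type of their bound variable, and the Γ in η1 and η2 is the context in which the redex occurs; for unannotated terms the claim fails, e.g. κ2 on (λf. f y1 y2)[N,N/y1,y2] with N=(λz.z)[], whose two copies can have different types. *)

(* Defs.v *)
From Stdlib Require Import List Arith Relations.
Import ListNotations.

Inductive type : Set :=
| Atom (a : nat)
| Arrow (A B : type)
| Box (A : type).

(** De Bruijn terms, so that alpha-equivalent terms are equal.
    - [Lam A M] is [lambda x. M]: in [M] the index 0 is [x] and [S i] is the
      outer variable [i].  The bound variable carries its type [A] (Church
      style).  Over unannotated terms subject reduction is false: for instance
      [(lambda z. z)[]] has both types [Box (a -> a)] and [Box (b -> b)], so in
      a typed term [M[N, N / y1, y2]] the two copies of [N] may have different
      types, and then they cannot be contracted by kappa2; similarly, the eta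
      steps need the type of the redex to be determined.
    - [Sub M [N_1; ...; N_n]] is [M[N_1, ..., N_n / x_1, ..., x_n]]: the body
      [M] lives in its own scope, where the index [i < n] is the variable bound
      to the [i]-th item of the list (counting from 0).  Outer variables are
      not visible in [M]. *)
Inductive term : Set :=
| Var (i : nat)
| Lam (A : type) (M : term)
| App (M N : term)
| Sub (M : term) (Ns : list term).

Inductive FV : term -> nat -> Prop :=
| FV_Var i : FV (Var i) i
| FV_Lam A N i : FV N (S i) -> FV (Lam A N) i
| FV_App_l N P i : FV N i -> FV (App N P) i
| FV_App_r N P i : FV P i -> FV (App N P) i
| FV_Sub N Ps P i : In P Ps -> FV P i -> FV (Sub N Ps) i.

Definition up_ren (r : nat -> nat) (i : nat) : nat :=
  match i with 0 => 0 | S j => S (r j) end.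

Fixpoint rename (r : nat -> nat) (M : term) : term :=
  match M with
  | Var i => Var (r i)
  | Lam A N => Lam A (rename (up_ren r) N)
  | App N P => App (rename r N) (rename r P)
  | Sub N Ps => Sub N (map (rename r) Ps)
  end.

Definition up (s : nat -> term) (i : nat) : term :=
  match i with 0 => Var 0 | S j => rename S (s j) end.

(** Capture-avoiding simultaneous substitution. *)
Fixpoint subst (s : nat -> term) (M : term) : term :=
  match M with
  | Var i => s i
  | Lam A N => Lam A (subst (up s) N)
  | App N P => App (subst s N) (subst s P)
  | Sub N Ps => Sub N (map (subst s) Ps)
  end.

(** The [i]-th item of a context is the type declared for the variable [i]. *)
Definition context : Set := list type.

Inductive typed : context -> term -> type -> Prop :=
| T_Id G i A :
    nth_error G i = Some A ->
    typed G (Var i) A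
| T_Abs G A M C :
    typed (A :: G) M C ->
    typed G (Lam A M) (Arrow A C)
| T_App G M N A C :
    typed G N A ->
    typed G M (Arrow A C) ->
    typed G (App M N) C
| T_BoxSubst G M Ns As C :
    Forall2 (fun N A => typed G N (Box A)) Ns As ->
    typed As M C ->
    typed G (Sub M Ns) (Box C).

Definition Lambda (M : term) : Prop := exists G A, typed G M A.

Definition Lambda_lam (M : term) : Prop :=
  Lambda M /\ exists A N, M = Lam A N.

Definition Lambda_box (M : term) : Prop :=
  Lambda M /\ exists N Ps, M = Sub N Ps.

Definition subst1 (N : term) (i : nat) : term :=
  match i with 0 => N | S j => Var j end.

(** [M{R/y}] in beta2, where [y] has index [p] in [M] and [R] binds [n]
    variables: the variables before [y] keep their index, those of [R] are moved
    to [p, ..., p + n - 1], and those after [y] are moved past them. *)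
Definition flatten_subst (p n : nat) (R : term) (i : nat) : term :=
  if i <? p then Var i
  else if i =? p then rename (Nat.add p) R
  else Var (i - 1 + n).

(** Sends both [p] and [p + 1] to [p] and renumbers the variables after them. *)
Definition merge (p i : nat) : nat := if i <=? p then i else i - 1.

(** Renumbers the variables after [p] when [p], which does not occur, is
    removed. *)
Definition skip (p i : nat) : nat := if i <? p then i else i - 1.

Inductive beta : term -> term -> Prop :=
| beta1 A M N :
    beta (App (Lam A M) N) (subst (subst1 N) M)
| beta2 M Ps R Ns Qs :
    beta (Sub M (Ps ++ Sub R Ns :: Qs))
         (Sub (subst (flatten_subst (length Ps) (length Ns) R) M)
              (Ps ++ Ns ++ Qs)).

(** The eta steps depend on the context [G] in which the redex is typed.
    Renaming [M] by [S] makes the variable of index 0 fresh for [M]. *)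
Inductive eta1 (G : context) : term -> term -> Prop :=
| eta1_intro M A B :
    typed G M (Arrow A B) ->
    ~ Lambda_lam M ->
    eta1 G M (Lam A (App (rename S M) (Var 0))).

(** No renaming is needed here: [M] is outside the scope of the bound
    variable. *)
Inductive eta2 (G : context) : term -> term -> Prop :=
| eta2_intro M A :
    typed G M (Box A) ->
    ~ Lambda_box M ->
    eta2 G M (Sub (Var 0) [M]).

Inductive kappa : term -> term -> Prop :=
| kappa1 M Ps N Qs :
    ~ FV M (length Ps) ->
    kappa (Sub M (Ps ++ N :: Qs))
          (Sub (rename (skip (length Ps)) M) (Ps ++ Qs))
| kappa2 M Ps N Qs :
    kappa (Sub M (Ps ++ N :: N :: Qs))
          (Sub (rename (merge (length Ps)) M) (Ps ++ N :: Qs)).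

(** Terms with a hole (the contexts [C]). *)
Inductive hterm : Set :=
| Hole
| HLam (A : type) (C : hterm)
| HAppR (M : term) (C : hterm)
| HAppL (C : hterm) (M : term)
| HSubBody (C : hterm) (Ms : list term)
| HSubArg (M : term) (Ns1 : list term) (C : hterm) (Ns2 : list term).

Inductive is_E : hterm -> Prop :=
| E_Hole : is_E Hole
| E_Lam A E : is_E E -> is_E (HLam A E)
| E_AppR M E : is_E E -> is_E (HAppR M E)
| E_AppL E M : is_E E -> E <> Hole -> is_E (HAppL E M)
| E_SubBody E Ms : is_E E -> is_E (HSubBody E Ms)
| E_SubArg M Ns1 E Ns2 : is_E E -> is_E (HSubArg M Ns1 E Ns2).

Inductive is_D : hterm -> Prop :=
| D_Hole : is_D Hole
| D_Lam A D : is_D D -> is_D (HLam A D)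
| D_AppR M D : is_D D -> is_D (HAppR M D)
| D_AppL D M : is_D D -> is_D (HAppL D M)
| D_SubBody D Ms : is_D D -> is_D (HSubBody D Ms)
| D_SubArg M Ns1 D Ns2 : is_D D -> D <> Hole -> is_D (HSubArg M Ns1 D Ns2).

Fixpoint plug (C : hterm) (M : term) : term :=
  match C with
  | Hole => M
  | HLam A C => Lam A (plug C M)
  | HAppR N C => App N (plug C M)
  | HAppL C N => App (plug C M) N
  | HSubBody C Ns => Sub (plug C M) Ns
  | HSubArg N Ns1 C Ns2 => Sub N (Ns1 ++ plug C M :: Ns2)
  end.

(** [hole_context G C D]: when the whole term is in context [G], the hole of
    [C] is in context [D].  The body of an explicit substitution is typed in
    the context given by the types of the substituted terms. *)
Inductive hole_context : context -> hterm -> context -> Prop :=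
| hc_Hole G : hole_context G Hole G
| hc_Lam G A C D : hole_context (A :: G) C D -> hole_context G (HLam A C) D
| hc_AppR G M C D : hole_context G C D -> hole_context G (HAppR M C) D
| hc_AppL G C M D : hole_context G C D -> hole_context G (HAppL C M) D
| hc_SubBody G C Ms As D :
    Forall2 (fun M A => typed G M (Box A)) Ms As ->
    hole_context As C D ->
    hole_context G (HSubBody C Ms) D
| hc_SubArg G M Ns1 C Ns2 D :
    hole_context G C D -> hole_context G (HSubArg M Ns1 C Ns2) D.

Inductive hclosure (R : term -> term -> Prop) : term -> term -> Prop :=
| hclosure_intro C M N : R M N -> hclosure R (plug C M) (plug C N).

Definition swap (p i : nat) : nat :=
  if i =? p then S p else if i =? S p then p else i.

(** Adjacent transpositions generate all simultaneous permutations of the pairs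
    [N_i/x_i]. *)
Inductive transpose : term -> term -> Prop :=
| transpose_intro M Ps N1 N2 Qs :
    transpose (Sub M (Ps ++ N1 :: N2 :: Qs))
              (Sub (rename (swap (length Ps)) M) (Ps ++ N2 :: N1 :: Qs)).

(** The congruence by which terms are identified. *)
Definition perm_equiv : term -> term -> Prop :=
  clos_refl_sym_trans term (hclosure transpose).

(** A step between equivalence classes is a step between some
    representatives. *)
Definition modulo_perm (R : term -> term -> Prop) (M N : term) : Prop :=
  exists M' N', perm_equiv M M' /\ R M' N' /\ perm_equiv N' N.

Definition red_beta : term -> term -> Prop := modulo_perm (hclosure beta).

Definition red_kappa : term -> term -> Prop := modulo_perm (hclosure kappa).

Inductive eta_closure (G : context) : term -> term -> Prop :=
| eta_closure1 E D M N :
    is_E E -> hole_context G E D -> eta1 D M N ->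
    eta_closure G (plug E M) (plug E N)
| eta_closure2 C D M N :
    is_D C -> hole_context G C D -> eta2 D M N ->
    eta_closure G (plug C M) (plug C N).

Definition red_eta (G : context) : term -> term -> Prop :=
  modulo_perm (eta_closure G).

Definition red (G : context) (M N : term) : Prop :=
  red_beta M N \/ red_eta G M N \/ red_kappa M N.

(* Main.v *)
(** Plugging is compositional: the hole of a term context is typed in a context
    and at a type read off from the surrounding derivation, and any other term
    with the same typing can be plugged in.  So each ground step only has to
    preserve types, which follows from stability of typing under renaming and
    substitution.  Since abstractions are annotated, types are unique: this
    gives the two copies of [N] in a kappa2 redex the same type, and identifies
    the context and type at which an eta redex is expanded with those of the
    surrounding derivation.  Transpositions of explicit substitutions preserve
    typing in both directions because [transpose] is symmetric. *)

From Stdlib Require Import List Arith Lia.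
Import ListNotations.
Require Import Defs.

Lemma Forall2_impl_map_l {T T' U} (f : T -> T') (R : T -> U -> Prop)
  (R' : T' -> U -> Prop) l l' :
  (forall x y, In x l -> R x y -> R' (f x) y) ->
  Forall2 R l l' -> Forall2 R' (map f l) l'.
Proof.
  intros Hf HR; induction HR; simpl in *; constructor; auto.
Qed.

Lemma Forall2_unique_r {T U} {R : T -> U -> Prop} {l l1 l2} :
  Forall2 (fun x y => forall z, R x z -> y = z) l l1 -> Forall2 R l l2 -> l1 = l2.
Proof.
  intros HR; revert l2; induction HR; inversion 1; subst; f_equal; auto.
Qed.

Lemma nth_error_app_Some {T} (l l' : list T) i x :
  nth_error l i = Some x -> nth_error (l ++ l') i = Some x.
Proof.
  intros Hi; rewrite nth_error_app1; [assumption |].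
  apply nth_error_Some; congruence.
Qed.

Lemma nth_error_app_add {T} (l l' : list T) i :
  nth_error (l ++ l') (length l + i) = nth_error l' i.
Proof.
  rewrite nth_error_app2 by lia; f_equal; lia.
Qed.

Lemma nth_error_app_cons_inv {T} (l l' : list T) x i y :
  nth_error (l ++ x :: l') i = Some y ->
  (i < length l /\ nth_error l i = Some y) \/
  (i = length l /\ x = y) \/
  (exists j, i = length l + S j /\ nth_error l' j = Some y).
Proof.
  intros Hi; destruct (Nat.lt_ge_cases i (length l)) as [Hlt | Hge].
  - left; now rewrite nth_error_app1 in Hi.
  - right; replace i with (length l + (i - length l)) in * by lia.
    rewrite nth_error_app_add in Hi.
    destruct (i - length l) as [| j]; simpl in Hi; [left | right].
    + split; [lia | congruence].
    + now exists j.
Qed.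

Local Ltac case_comparisons :=
  repeat match goal with
  | |- context [?a =? ?b] => destruct (Nat.eqb_spec a b)
  | |- context [?a <? ?b] => destruct (Nat.ltb_spec a b)
  | |- context [?a <=? ?b] => destruct (Nat.leb_spec a b)
  end.

Lemma swap_involutive p i : swap p (swap p i) = i.
Proof.
  unfold swap at 2; case_comparisons; unfold swap; case_comparisons; lia.
Qed.

Lemma swap_S p i : swap (S p) (S i) = S (swap p i).
Proof. unfold swap; case_comparisons; lia. Qed.

Lemma skip_S p i : i <> p -> skip (S p) (S i) = S (skip p i).
Proof. unfold skip; case_comparisons; lia. Qed.

Lemma merge_S p i : merge (S p) (S i) = S (merge p i).
Proof. unfold merge; case_comparisons; lia. Qed.

Lemma nth_error_swap {T} (l l' : list T) x y i :
  nth_error (l ++ y :: x :: l') (swap (length l) i) =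
  nth_error (l ++ x :: y :: l') i.
Proof.
  revert i; induction l as [| z l IH]; intros i.
  - now destruct i as [| [| i]].
  - destruct i as [| i]; [reflexivity |].
    simpl length; rewrite swap_S; apply IH.
Qed.

Lemma nth_error_skip {T} (l l' : list T) x i :
  i <> length l ->
  nth_error (l ++ l') (skip (length l) i) = nth_error (l ++ x :: l') i.
Proof.
  revert i; induction l as [| z l IH]; intros i Hi.
  - destruct i as [| i]; [contradiction |].
    unfold skip; simpl; now rewrite Nat.sub_0_r.
  - destruct i as [| i]; [reflexivity |].
    simpl in *; rewrite skip_S by lia; apply IH; lia.
Qed.

Lemma nth_error_merge {T} (l l' : list T) x i :
  nth_error (l ++ x :: l') (merge (length l) i) = nth_error (l ++ x :: x :: l') i.
Proof.
  revert i; induction l as [| z l IH]; intros i.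
  - destruct i as [| i]; [reflexivity |].
    unfold merge; simpl; now rewrite Nat.sub_0_r.
  - destruct i as [| i]; [reflexivity |].
    simpl length; rewrite merge_S; apply IH.
Qed.

Lemma term_nested_ind (P : term -> Prop)
  (HVar : forall i, P (Var i))
  (HLam : forall A M, P M -> P (Lam A M))
  (HApp : forall M N, P M -> P N -> P (App M N))
  (HSub : forall M Ns, P M -> Forall P Ns -> P (Sub M Ns)) :
  forall M, P M.
Proof.
  fix IH 1; intros [i | A M | M N | M Ns].
  - apply HVar.
  - apply HLam, IH.
  - apply HApp; apply IH.
  - apply HSub; [apply IH |].
    induction Ns; constructor; [apply IH | assumption].
Qed.

Lemma typed_nested_ind (P : context -> term -> type -> Prop)
  (HId : forall G i A, nth_error G i = Some A -> P G (Var i) A)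
  (HAbs : forall G A M C, P (A :: G) M C -> P G (Lam A M) (Arrow A C))
  (HApp : forall G M N A C, P G N A -> P G M (Arrow A C) -> P G (App M N) C)
  (HBox : forall G M Ns As C,
      Forall2 (fun N A => P G N (Box A)) Ns As -> typed As M C ->
      P As M C -> P G (Sub M Ns) (Box C)) :
  forall G M A, typed G M A -> P G M A.
Proof.
  fix IH 4; intros G M A [G' i A' Hi | G' A' M' C' HM | G' M' N' A' C' HN HM
                         | G' M' Ns As C' HNs HM].
  - apply HId, Hi.
  - apply HAbs, IH, HM.
  - apply HApp with A'; apply IH; assumption.
  - apply HBox with As; [| exact HM | apply IH, HM].
    clear HM; induction HNs; constructor; [apply IH |]; assumption.
Qed.

Local Notation box_typed G := (Forall2 (fun N A => typed G N (Box A))).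

Lemma typed_Sub_app G M Ps Qs As Bs C :
  box_typed G Ps As -> box_typed G Qs Bs -> typed (As ++ Bs) M C ->
  typed G (Sub M (Ps ++ Qs)) (Box C).
Proof.
  intros HPs HQs; apply T_BoxSubst, Forall2_app; assumption.
Qed.

Lemma typed_Sub_app_inv G M Ps Qs A :
  typed G (Sub M (Ps ++ Qs)) A ->
  exists As Bs C, A = Box C /\ box_typed G Ps As /\ box_typed G Qs Bs /\
    typed (As ++ Bs) M C.
Proof.
  inversion 1 as [| | | ? ? ? Ds C HNs HM]; subst.
  apply Forall2_app_inv_l in HNs as (As & Bs & HPs & HQs & ->).
  now exists As, Bs, C.
Qed.

Lemma typed_unique {G M A B} : typed G M A -> typed G M B -> A = B.
Proof.
  intros HA; revert B; induction HA as [G i A Hi | G A M C IH | G M N A C _ IH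
    | G M Ns As C IHNs _ IH] using typed_nested_ind; intros B HB;
    inversion HB as [? ? ? Hi' | ? ? ? ? HM | ? ? ? ? ? _ HM | ? ? ? Bs ? HNs HM];
    subst.
  - congruence.
  - f_equal; auto.
  - apply IH in HM; congruence.
  - assert (As = Bs) as <-.
    { refine (Forall2_unique_r (Forall2_impl _ _ IHNs) HNs).
      intros N A IHN A' HN; apply IHN in HN; congruence. }
    f_equal; auto.
Qed.

Lemma box_typed_unique {G Ns As Bs} :
  box_typed G Ns As -> box_typed G Ns Bs -> As = Bs.
Proof.
  intros HAs; apply Forall2_unique_r, Forall2_impl with (2 := HAs).
  intros N A HA B HB; pose proof (typed_unique HA HB); congruence.
Qed.

Lemma typed_rename G M A G' r :
  typed G M A ->
  (forall i B, FV M i -> nth_error G i = Some B -> nth_error G' (r i) = Some B) ->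
  typed G' (rename r M) A.
Proof.
  intros HM; revert G' r; induction HM as [G i A Hi | G A M C IH
    | G M N A C IHN IHM | G M Ns As C IHNs HM _] using typed_nested_ind;
    intros G' r Hr; simpl.
  - constructor; apply Hr; [constructor | assumption].
  - constructor; apply IH; intros [| i] B Hi HB; simpl in *; auto using FV_Lam.
  - apply T_App with A; [apply IHN | apply IHM]; auto using FV_App_l, FV_App_r.
  - apply T_BoxSubst with As; [| assumption].
    apply Forall2_impl_map_l with (2 := IHNs); eauto using FV_Sub.
Qed.

Lemma typed_weaken G M A B : typed G M A -> typed (B :: G) (rename S M) A.
Proof.
  intros HM; apply typed_rename with (1 := HM); auto.
Qed.

Lemma typed_subst G M A G' s :
  typed G M A ->
  (forall i B, nth_error G i = Some B -> typed G' (s i) B) ->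
  typed G' (subst s M) A.
Proof.
  intros HM; revert G' s; induction HM as [G i A Hi | G A M C IH
    | G M N A C IHN IHM | G M Ns As C IHNs HM _] using typed_nested_ind;
    intros G' s Hs; simpl.
  - auto.
  - constructor; apply IH; intros [| i] B HB; simpl in *;
      auto using T_Id, typed_weaken.
  - apply T_App with A; auto.
  - apply T_BoxSubst with As; [| assumption].
    apply Forall2_impl_map_l with (2 := IHNs); auto.
Qed.

Lemma typed_subst1 G A M N C :
  typed (A :: G) M C -> typed G N A -> typed G (subst (subst1 N) M) C.
Proof.
  intros HM HN; apply typed_subst with (1 := HM); intros [| i] B HB; simpl in *.
  - congruence.
  - now constructor.
Qed.

Lemma typed_flatten_subst As A Bs Cs M R C :
  typed (As ++ A :: Cs) M C -> typed Bs R A ->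
  typed (As ++ Bs ++ Cs) (subst (flatten_subst (length As) (length Bs) R) M) C.
Proof.
  intros HM HR; apply typed_subst with (1 := HM); intros i B Hi.
  unfold flatten_subst.
  apply nth_error_app_cons_inv in Hi as [[Hlt Hi] | [[-> <-] | (j & -> & Hj)]].
  - apply Nat.ltb_lt in Hlt as ->.
    now apply T_Id, nth_error_app_Some.
  - rewrite Nat.ltb_irrefl, Nat.eqb_refl.
    apply typed_rename with (1 := HR); intros j B _ Hj.
    now rewrite nth_error_app_add; apply nth_error_app_Some.
  - case_comparisons; try lia.
    apply T_Id.
    replace (length As + S j - 1 + length Bs)
      with (length As + (length Bs + j)) by lia.
    now rewrite !nth_error_app_add.
Qed.

Lemma rename_cancel {r r'} M :
  (forall i, r' (r i) = i) -> rename r' (rename r M) = M.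
Proof.
  revert r r'; induction M as [i | A M IH | M N IHM IHN | M Ns _ IHNs]
    using term_nested_ind; intros r r' Hr; simpl; f_equal; auto.
  - apply IH; intros [| i]; simpl; auto.
  - rewrite map_map; rewrite <- map_id.
    apply map_ext_Forall, Forall_impl with (2 := IHNs); auto.
Qed.

Lemma transpose_sym M N : transpose M N -> transpose N M.
Proof.
  intros [M' Ps N1 N2 Qs].
  rewrite <- (rename_cancel M' (swap_involutive (length Ps))) at 2.
  constructor.
Qed.

Definition preserves_typing (G : context) (R : term -> term -> Prop) : Prop :=
  forall M N A, R M N -> typed G M A -> typed G N A.

Lemma transpose_preserves_typing G : preserves_typing G transpose.
Proof.
  intros _ _ T [M Ps N1 N2 Qs] H.
  apply typed_Sub_app_inv in H as (As & Bs & C & -> & HPs & HBs & HM).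
  inversion HBs as [| ? A1 ? ? HN1 HBs'];
    inversion HBs' as [| ? A2 ? Bs' HN2 HQs]; subst.
  apply typed_Sub_app with As (A2 :: A1 :: Bs'); [assumption | auto |].
  apply typed_rename with (1 := HM); intros i B _ HB.
  now rewrite (Forall2_length HPs), nth_error_swap.
Qed.

Lemma beta_preserves_typing G : preserves_typing G beta.
Proof.
  intros _ _ T [A M N | M Ps R Ns Qs] H.
  - inversion H as [| | ? ? ? B ? HN HL |]; inversion HL; subst.
    now apply typed_subst1 with B.
  - apply typed_Sub_app_inv in H as (As & Bs & C & -> & HPs & HBs & HM).
    inversion HBs as [| ? B ? Bs' HR HQs]; subst.
    inversion HR as [| | | ? ? ? Ds ? HNs HR']; subst.
    apply typed_Sub_app with As (Ds ++ Bs'); [assumption | now apply Forall2_app |].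
    rewrite (Forall2_length HPs), (Forall2_length HNs).
    now apply typed_flatten_subst with B.
Qed.

Lemma kappa_preserves_typing G : preserves_typing G kappa.
Proof.
  intros _ _ T [M Ps N Qs Hfresh | M Ps N Qs] H;
    apply typed_Sub_app_inv in H as (As & Bs & C & -> & HPs & HBs & HM);
    rewrite (Forall2_length HPs) in *.
  - inversion HBs as [| ? B ? Bs' _ HQs]; subst.
    apply typed_Sub_app with As Bs'; [assumption .. |].
    apply typed_rename with (1 := HM); intros i D Hi HD.
    rewrite nth_error_skip with (x := B); [assumption | congruence].
  - inversion HBs as [| ? B1 ? ? HN1 HBs'];
      inversion HBs' as [| ? B2 ? Bs' HN2 HQs]; subst.
    assert (Heq : Box B1 = Box B2) by exact (typed_unique HN1 HN2).
    injection Heq as <-.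
    apply typed_Sub_app with As (B1 :: Bs'); [assumption | auto |].
    apply typed_rename with (1 := HM); intros i D _ HD.
    now rewrite nth_error_merge.
Qed.

Lemma eta1_preserves_typing G : preserves_typing G (eta1 G).
Proof.
  intros _ _ T [M A B HM _] HT; rewrite (typed_unique HT HM).
  apply T_Abs, T_App with A; [now apply T_Id | now apply typed_weaken].
Qed.

Lemma eta2_preserves_typing G : preserves_typing G (eta2 G).
Proof.
  intros _ _ T [M A HM _] HT; rewrite (typed_unique HT HM).
  apply T_BoxSubst with [A]; [auto | now apply T_Id].
Qed.

Lemma hole_context_unique {G C D D'} :
  hole_context G C D -> hole_context G C D' -> D = D'.
Proof.
  induction 1 as [| | | | G C Ms As D HMs _ IH |];
    inversion 1 as [| | | | ? ? ? Bs ? HMs' HC |]; subst; auto.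
  apply IH; now rewrite (box_typed_unique HMs HMs').
Qed.

Lemma typed_plug_inv G C M A :
  typed G (plug C M) A ->
  exists D B, hole_context G C D /\ typed D M B /\
    forall N, typed D N B -> typed G (plug C N) A.
Proof.
  revert G A; induction C as [| B C IH | P C IH | C IH P | C IH Ps | P Ns1 C IH Ns2];
    simpl; intros G A HM.
  - exists G, A; auto using hc_Hole.
  - inversion HM as [| ? ? ? ? HB | |]; subst.
    apply IH in HB as (D & T & HC & HT & Hplug).
    exists D, T; auto using hc_Lam, T_Abs.
  - inversion HM as [| | ? ? ? ? ? HB HP |]; subst.
    apply IH in HB as (D & T & HC & HT & Hplug).
    exists D, T; eauto 6 using hc_AppR, T_App.
  - inversion HM as [| | ? ? ? ? ? HP HB |]; subst.
    apply IH in HB as (D & T & HC & HT & Hplug).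
    exists D, T; eauto 6 using hc_AppL, T_App.
  - inversion HM as [| | | ? ? ? As ? HPs HB]; subst.
    apply IH in HB as (D & T & HC & HT & Hplug).
    exists D, T; eauto 6 using hc_SubBody, T_BoxSubst.
  - apply typed_Sub_app_inv in HM as (As & Bs & E & -> & HNs1 & HBs & HP).
    inversion HBs as [| ? B ? Bs' HB HNs2]; subst.
    apply IH in HB as (D & T & HC & HT & Hplug).
    exists D, T; eauto 7 using hc_SubArg, typed_Sub_app.
Qed.

Lemma hclosure_preserves_typing {R} :
  (forall G, preserves_typing G R) -> forall G, preserves_typing G (hclosure R).
Proof.
  intros HR G _ _ A [C M N HMN] HM.
  apply typed_plug_inv in HM as (D & B & _ & HB & Hplug).
  exact (Hplug N (HR D M N B HMN HB)).
Qed.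

Lemma eta_closure_preserves_typing G : preserves_typing G (eta_closure G).
Proof.
  intros _ _ A [C D M N _ HC HMN | C D M N _ HC HMN] HM;
    apply typed_plug_inv in HM as (D' & B & HC' & HB & Hplug);
    rewrite (hole_context_unique HC' HC) in *; apply Hplug.
  - exact (eta1_preserves_typing D M N B HMN HB).
  - exact (eta2_preserves_typing D M N B HMN HB).
Qed.

Lemma hclosure_sym R :
  (forall M N, R M N -> R N M) -> forall M N, hclosure R M N -> hclosure R N M.
Proof.
  intros HR _ _ [C M N HMN]; constructor; auto.
Qed.

Lemma typed_perm_equiv {G M N A} :
  perm_equiv M N -> typed G M A <-> typed G N A.
Proof.
  induction 1 as [M N HMN | | | M N P _ IH1 _ IH2]; [| tauto ..].
  pose proof (hclosure_preserves_typing transpose_preserves_typing G) as Hpres.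
  split; apply Hpres; [assumption |].
  now apply hclosure_sym; [apply transpose_sym |].
Qed.

Lemma modulo_perm_preserves_typing G R :
  preserves_typing G R -> preserves_typing G (modulo_perm R).
Proof.
  intros HR M N A (M' & N' & HM & HMN & HN).
  rewrite (typed_perm_equiv HM), <- (typed_perm_equiv HN).
  exact (HR M' N' A HMN).
Qed.

Theorem theorem3p6 (G : context) (M N : term) (C : type)
  (HM : typed G M C) (Hred : red G M N) :
  typed G N C.
Proof.
  destruct Hred as [H | [H | H]];
    refine (modulo_perm_preserves_typing G _ _ M N C H HM).
  - apply hclosure_preserves_typing, beta_preserves_typing.
  - apply eta_closure_preserves_typing.
  - apply hclosure_preserves_typing, kappa_preserves_typing.
Qed.
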